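(* Let $n\ge0$ and $k\ge1$ be integers, and let $T$ be the triangle with vertices $(P_n,P_{n+k})$, $(P_{n+2k},P_{n+3k})$, $(P_{n+4k},P_{n+5k})$. Then the area of $T$ equals $4P_k^4Q_k$ if $k$ is even, and $\dfrac{P_k^2Q_k^3}{2}$ if $k$ is odd.
   Context: $P_n$ denotes the Pell numbers ($P_0=0$, $P_1=1$, $P_{n+1}=2P_n+P_{n-1}$) and $Q_n$ the Pell–Lucas numbers ($Q_0=2$, $Q_1=2$, $Q_{n+1}=2Q_n+Q_{n-1}$), i.e. $P_n=\frac{(1+\sqrt2)^n-(1-\sqrt2)^n}{2\sqrt2}$, $Q_n=(1+\sqrt2)^n+(1-\sqrt2)^n$. The area of the triangle with vertices $(x_1,y_1),(x_2,y_2),(x_3,y_3)$ is $\frac12\left|(x_2-x_1)(y_3-y_1)-(x_3-x_1)(y_2-y_1)\right|$. *)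

(* Defs.v *)
From mathcomp Require Import all_boot all_order all_algebra.

Set Implicit Arguments.
Unset Strict Implicit.
Unset Printing Implicit Defensive.

Import Order.TTheory GRing.Theory Num.Theory.

Fixpoint pell (n : nat) : nat :=
  match n with
  | 0 => 0
  | 1 => 1
  | (m.+1 as n').+1 => 2 * pell n' + pell m
  end.

Fixpoint pell_lucas (n : nat) : nat :=
  match n with
  | 0 => 2
  | 1 => 2
  | (m.+1 as n').+1 => 2 * pell_lucas n' + pell_lucas m
  end.

Local Open Scope ring_scope.

Definition triangle_area (R : realFieldType) (A B C : R * R) : R :=
  `|(B.1 - A.1) * (C.2 - A.2) - (C.1 - A.1) * (B.2 - A.2)| / 2%:R.

Definition pell_point (R : realFieldType) (a b : nat) : R * R :=
  ((pell a)%:R, (pell b)%:R).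

(* Main.v *)
(* Writing u_j = P_{n+jk}, the sequence u satisfies u_{j+2} = Q_k u_{j+1} - (-1)^k u_j.
   Expressing u_2, ..., u_5 through u_0 and u_1 makes twice the signed area a multiple
   of the form u_1^2 - Q_k u_0 u_1 + (-1)^k u_0^2, which equals (-1)^n P_k^2; the
   cofactor is Q_k (Q_k^2 - 4) = 8 P_k^2 Q_k for k even and Q_k^3 for k odd. *)
Require Import Defs.
From mathcomp Require Import all_boot all_order all_algebra.
From mathcomp Require Import ring zify.

Import Order.TTheory GRing.Theory Num.Theory.
Local Open Scope ring_scope.

Lemma pellSS n : pell n.+2 = (2 * pell n.+1 + pell n)%N.
Proof. by []. Qed.

Lemma pell_addS m k :
  pell (m + k).+1 = (pell m.+1 * pell k.+1 + pell m * pell k)%N.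
Proof.
elim: m k => [|m IHm] k; first by rewrite add0n mul1n mul0n addn0.
by rewrite addSnnS IHm !pellSS; nia.
Qed.

Lemma pell_lucasE n : (pell_lucas n + 2 * pell n = 2 * pell n.+1)%N.
Proof.
(* The recurrence has order two, so the induction carries two consecutive instances. *)
suff [] : (pell_lucas n + 2 * pell n = 2 * pell n.+1 /\
           pell_lucas n.+1 + 2 * pell n.+1 = 2 * pell n.+2)%N by [].
elim: n => [|n [IHn IHSn]] //; split=> //.
have -> : pell_lucas n.+2 = (2 * pell_lucas n.+1 + pell_lucas n)%N by [].
by move: IHn IHSn; rewrite (pellSS n.+1) (pellSS n); lia.
Qed.

Section PellRing.

Variable R : comPzRingType.
Local Notation P n := ((pell n)%:R : R).
Local Notation Q n := ((pell_lucas n)%:R : R).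

Lemma natr_pellSS n : P n.+2 = 2%:R * P n.+1 + P n.
Proof. by rewrite pellSS natrD natrM. Qed.

Lemma natr_pell_addS m k : P (m + k).+1 = P m.+1 * P k.+1 + P m * P k.
Proof. by rewrite pell_addS natrD !natrM. Qed.

(** The factor [P k.+1 - 2%:R * P k] is $P_{k-1}$, written so that $k=0$ is covered, with
    $P_{-1}=1$. *)
Lemma natr_pell_add m k :
  P (m + k) = P m.+1 * P k + P m * (P k.+1 - 2%:R * P k).
Proof.
have := natr_pell_addS m k.+1.
rewrite addnS natr_pellSS natr_pell_addS natr_pellSS => E.
by rewrite -[LHS](addKr (2%:R * (P m.+1 * P k.+1 + P m * P k))) E; ring.
Qed.

Lemma natr_pell_lucas n : Q n = 2%:R * P n.+1 - 2%:R * P n.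
Proof. by rewrite -!natrM -pell_lucasE natrD addrK. Qed.

(** The form $x^2-2xy-y^2$ changes sign under $(x,y)\mapsto(2x+y,x)$. *)
Lemma pell_cassini n :
  P n.+1 ^+ 2 - 2%:R * P n * P n.+1 - P n ^+ 2 = (-1) ^+ n.
Proof.
elim: n => [|n IHn]; first by rewrite /=; ring.
by rewrite [RHS]exprS -IHn natr_pellSS; ring.
Qed.

(** Cayley-Hamilton for the $k$-th power of the matrix with rows $(2,1)$ and $(1,0)$: its trace is
    $Q_k$, its determinant $(-1)^k$. *)
Lemma pell_step m k :
  P (m + k + k) = Q k * P (m + k) - (-1) ^+ k * P m.
Proof.
rewrite (natr_pell_add (m + k)) natr_pell_addS natr_pell_add natr_pell_lucas.
by rewrite -pell_cassini; ring.
Qed.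

(** Expanding $P_{n+k}$ by the addition formula turns the left side into $P_k^2$ times the Cassini
    form at $n$. *)
Lemma pell_step_form n k :
  P (n + k) ^+ 2 - Q k * P n * P (n + k) + (-1) ^+ k * P n ^+ 2
  = (-1) ^+ n * P k ^+ 2.
Proof.
by rewrite natr_pell_add natr_pell_lucas -!pell_cassini; ring.
Qed.

Lemma pell_lucas_sqr k : Q k ^+ 2 = 8%:R * P k ^+ 2 + 4%:R * (-1) ^+ k.
Proof. by rewrite natr_pell_lucas -pell_cassini; ring. Qed.

End PellRing.

Theorem theorem2p5 (R : realFieldType) (n k : nat) (hk : (1 <= k)%N) :
  let area := triangle_area (pell_point R n (n + k))
                            (pell_point R (n + 2 * k) (n + 3 * k))
                            (pell_point R (n + 4 * k) (n + 5 * k)) in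
  (~~ odd k -> area = 4%:R * (pell k)%:R ^+ 4 * (pell_lucas k)%:R) /\
  (odd k -> area = (pell k)%:R ^+ 2 * (pell_lucas k)%:R ^+ 3 / 2%:R).
Proof.
rewrite /triangle_area /pell_point /=.
have -> : (n + 2 * k = n + k + k)%N by lia.
have -> : (n + 3 * k = n + k + k + k)%N by lia.
have -> : (n + 4 * k = n + k + k + k + k)%N by lia.
have -> : (n + 5 * k = n + k + k + k + k + k)%N by lia.
have form := pell_step_form R n k.
have lucas2 := pell_lucas_sqr R k.
rewrite !pell_step; move: form lucas2; rewrite -(signr_odd _ k).
set a := (pell n)%:R; set b := (pell (n + k))%:R.
set p := (pell k)%:R; set q := (pell_lucas k)%:R.
have p_ge0 : 0 <= p by apply: ler0n.
have q_ge0 : 0 <= q by apply: ler0n.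
case: (odd k) => /= form lucas2; split=> // _.
- set D := (X in `|X|).
  have -> : D = (-1) ^+ n * (p ^+ 2 * q ^+ 3).
    by rewrite mulrA -form /D; ring.
  by rewrite normrMsign ger0_norm ?mulr_ge0 ?exprn_ge0.
- set D := (X in `|X|).
  have -> : D = (-1) ^+ n * (8%:R * p ^+ 4 * q).
    (* [D] is a polynomial in [a], [b], [q], so both factors [p ^+ 2] must go: one through [form],
       the other, with the 8, through [lucas2]. *)
    have -> : (-1) ^+ n * (8%:R * p ^+ 4 * q)
            = (-1) ^+ n * p ^+ 2 * (q * (8%:R * p ^+ 2)) by ring.
    have -> : 8%:R * p ^+ 2 = q ^+ 2 - 4%:R by rewrite lucas2; ring.
    by rewrite -form /D; ring.
  by rewrite normrMsign ger0_norm ?mulr_ge0 ?exprn_ge0 ?ler0n //; field.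
Qed.
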